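(* Let $A$ be a unital $C^*$-algebra. If the unitary group $\mathrm{U}(A)$ is amenable in the norm topology, then $A$ is strongly amenable.
   Context: Amenability of topological groups: for a topological group $G$, $\mathrm{RUCB}(G)$ is the space of bounded functions $f\colon G\to\mathbb{C}$ with $\lim_{x\to 1}\|f_x-f\|_\infty=0$, where $f_x(y)=f(xy)$. $G$ is amenable if there is $\mu\in \mathrm{RUCB}(G)^*$ with $\mu(1)=\|\mu\|=1$ and $\mu(f_x)=\mu(f)$ for all $x\in G$, $f\in\mathrm{RUCB}(G)$. Strong amenability: let $\|\cdot\|_\wedge$ be the projective tensor norm on the algebraic tensor product $A\otimes_{\mathbb{C}}A$, with its natural $A$-bimodule structure, and let $m\colon A\otimes_{\mathbb{C}} A\to A$ be the multiplication. An approximate diagonal for $A$ is a net $(\Delta_i)_i$ in $A\otimes_{\mathbb{C}}A$ such that $\|\Delta_i\|_\wedge$ is uniformly bounded, $(m(\Delta_i))_i$ is an approximate unit for $A$, and $\|a\Delta_i-\Delta_i a\|_\wedge\to 0$ for every $a\in A$. It is symmetric if each $\Delta_i$ is invariant under the flip $x\otimes y\mapsto y\otimes x$. $A$ is strongly amenable if it has a symmetric approximate diagonal contained in the convex hull of $\{u^*\otimes u : u\in\mathrm{U}(A)\}$. *)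

(* Defs.v *)
From HB Require Import structures.
From mathcomp Require Import all_boot all_order all_algebra.
From mathcomp Require Import all_classical all_reals all_analysis.
From mathcomp Require Import generic_quotient complex.

Set Implicit Arguments.
Unset Strict Implicit.
Unset Printing Implicit Defensive.

Import Order.TTheory GRing.Theory Num.Theory.
Import numFieldNormedType.Exports.

Local Open Scope classical_set_scope.
Local Open Scope quotient_scope.
Local Open Scope ring_scope.

(* The algebraic tensor product: formal sums of pairs, encoded as lists, modulo
   the congruence generated by commutativity and bilinearity. *)
Section Tensor.
Context (K : comNzRingType) (U V : lmodType K).

Inductive tensor_rel : seq (U * V) -> seq (U * V) -> Prop :=
| TensorRefl s : tensor_rel s s
| TensorSym s t : tensor_rel s t -> tensor_rel t s
| TensorTrans s t r : tensor_rel s t -> tensor_rel t r -> tensor_rel s r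
| TensorCat s s' t t' :
    tensor_rel s s' -> tensor_rel t t' -> tensor_rel (s ++ t) (s' ++ t')
| TensorCatC s t : tensor_rel (s ++ t) (t ++ s)
| TensorZero v : tensor_rel [:: (0, v)] [::]
| TensorAddl u u' v : tensor_rel [:: (u + u', v)] [:: (u, v); (u', v)]
| TensorAddr u v v' : tensor_rel [:: (u, v + v')] [:: (u, v); (u, v')]
| TensorScale a u v : tensor_rel [:: (a *: u, v)] [:: (u, a *: v)].

Definition tensor_equiv (s t : seq (U * V)) : bool := `[< tensor_rel s t >].

Lemma tensor_equivP : equiv_class_of tensor_equiv.
Proof.
split=> [s|s t|t s r]; first by apply/asboolP; exact: TensorRefl.
- by apply/asboolP/asboolP; exact: TensorSym.
- by move=> /asboolP st /asboolP tr; apply/asboolP; exact: TensorTrans st tr.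
Qed.

Canonical tensor_equiv_rel := EquivRelPack tensor_equivP.
Canonical tensor_encModRel := defaultEncModRel tensor_equiv.

Definition tensor : Type := {eq_quot tensor_equiv}.

HB.instance Definition _ := Choice.on tensor.
HB.instance Definition _ : EqQuotient _ tensor_equiv tensor :=
  EqQuotient.on tensor.

Local Notation pi := (\pi_tensor%qT : seq (U * V) -> tensor).
Local Notation scale_seq a s := [seq (a *: p.1, p.2) | p <- s].

Lemma tensor_piP s t : pi s = pi t <-> tensor_rel s t.
Proof.
split; first by move/eqP; rewrite eqmodE => /asboolP.
by move=> st; apply/eqP; rewrite eqmodE; exact/asboolP.
Qed.

Lemma tensor_reprP s : tensor_rel (repr (pi s)) s.
Proof. by apply/tensor_piP; rewrite reprK. Qed.

Lemma tensor_rel_scale a s t :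
  tensor_rel s t -> tensor_rel (scale_seq a s) (scale_seq a t).
Proof.
elim=> {s t} [s|s t _|s t r _ + _|s s' t t' _ + _|s t|v|u u' v|u v v'|b u v] /=.
- exact: TensorRefl.
- exact: TensorSym.
- exact: TensorTrans.
- by rewrite !map_cat; exact: TensorCat.
- by rewrite !map_cat; exact: TensorCatC.
- by rewrite scaler0; exact: TensorZero.
- by rewrite scalerDr; exact: TensorAddl.
- exact: TensorAddr.
- by rewrite scalerA mulrC -scalerA; exact: TensorScale.
Qed.

Definition tensor_zero : tensor := pi [::].
Fact tensor_key : unit. Proof. by []. Qed.
Definition tensor_add : tensor -> tensor -> tensor :=
  locked_with tensor_key (fun x y => pi (repr x ++ repr y)).
Definition tensor_scale : K -> tensor -> tensor :=
  locked_with tensor_key (fun a x => pi (scale_seq a (repr x))).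
Definition tensor_opp (x : tensor) : tensor := tensor_scale (-1) x.

Lemma tensor_addE s t : tensor_add (pi s) (pi t) = pi (s ++ t).
Proof. by rewrite [tensor_add]unlock; apply/tensor_piP/TensorCat; exact: tensor_reprP. Qed.

Lemma tensor_scaleE a s : tensor_scale a (pi s) = pi (scale_seq a s).
Proof. by rewrite [tensor_scale]unlock; apply/tensor_piP/tensor_rel_scale/tensor_reprP. Qed.

Lemma tensor_addA : associative tensor_add.
Proof.
move=> x y z; rewrite -[x]reprK -[y]reprK -[z]reprK.
by rewrite !tensor_addE catA.
Qed.

Lemma tensor_addC : commutative tensor_add.
Proof.
move=> x y; rewrite -[x]reprK -[y]reprK !tensor_addE.
exact/tensor_piP/TensorCatC.
Qed.

Lemma tensor_add0 : left_id tensor_zero tensor_add.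
Proof. by move=> x; rewrite -[x]reprK tensor_addE. Qed.

Lemma tensor_scaleDr a : {morph tensor_scale a : x y / tensor_add x y}.
Proof.
move=> x y; rewrite -[x]reprK -[y]reprK.
by rewrite !(tensor_addE, tensor_scaleE) map_cat.
Qed.

Lemma tensor_scaleDl x :
  {morph tensor_scale^~ x : a b / a + b >-> tensor_add a b}.
Proof.
move=> a b; rewrite -[x]reprK !tensor_scaleE tensor_addE.
have consE p s : pi (p :: s) = tensor_add (pi [:: p]) (pi s).
  by rewrite tensor_addE.
rewrite -tensor_addE; elim: (repr x) => [|p s IHs] /=.
  by rewrite tensor_addE.
rewrite [LHS]consE IHs (consE (a *: p.1, _)) (consE (b *: p.1, _)) scalerDl.
have -> : pi [:: (a *: p.1 + b *: p.1, p.2)] =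
    tensor_add (pi [:: (a *: p.1, p.2)]) (pi [:: (b *: p.1, p.2)]).
  by rewrite tensor_addE; exact/tensor_piP/TensorAddl.
rewrite -!tensor_addA; congr tensor_add.
by rewrite !tensor_addA (tensor_addC (pi [:: (b *: p.1, p.2)])).
Qed.

Lemma tensor_scaleA a b x :
  tensor_scale a (tensor_scale b x) = tensor_scale (a * b) x.
Proof.
rewrite -[x]reprK !tensor_scaleE -map_comp; congr pi.
by apply: eq_map => p /=; rewrite scalerA.
Qed.

Lemma tensor_scale1 : left_id 1 tensor_scale.
Proof.
move=> x; rewrite -[x]reprK tensor_scaleE; congr pi.
by rewrite -[RHS]map_id; apply: eq_map => -[u v] /=; rewrite scale1r.
Qed.

Lemma tensor_scale0 x : tensor_scale 0 x = tensor_zero.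
Proof.
rewrite -[x]reprK tensor_scaleE /tensor_zero.
elim: (repr x) => //= p s IHs.
rewrite -cat1s -tensor_addE IHs scale0r tensor_addC tensor_add0.
exact/tensor_piP/TensorZero.
Qed.

Lemma tensor_addN : left_inverse tensor_zero tensor_opp tensor_add.
Proof.
move=> x; rewrite -{2}[x]tensor_scale1 -tensor_scaleDl addNr.
exact: tensor_scale0.
Qed.

HB.instance Definition _ := GRing.isZmodule.Build tensor
  tensor_addA tensor_addC tensor_add0 tensor_addN.

HB.instance Definition _ := GRing.Zmodule_isLmodule.Build K tensor
  tensor_scaleA tensor_scale1 tensor_scaleDr (fun x => tensor_scaleDl x).

Definition pure_tensor (u : U) (v : V) : tensor := pi [:: (u, v)].

Lemma pure_tensorDl u u' v : pure_tensor (u + u') v = pure_tensor u v + pure_tensor u' v.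
Proof. by rewrite [RHS]tensor_addE; exact/tensor_piP/TensorAddl. Qed.

Lemma pure_tensorDr u v v' : pure_tensor u (v + v') = pure_tensor u v + pure_tensor u v'.
Proof. by rewrite [RHS]tensor_addE; exact/tensor_piP/TensorAddr. Qed.

Lemma pure_tensorZl a u v : pure_tensor (a *: u) v = a *: pure_tensor u v.
Proof. by rewrite [RHS]tensor_scaleE. Qed.

Lemma pure_tensorZr a u v : pure_tensor u (a *: v) = a *: pure_tensor u v.
Proof. by rewrite -pure_tensorZl; exact/esym/tensor_piP/TensorScale. Qed.

Lemma tensor_piE s : pi s = \sum_(p <- s) pure_tensor p.1 p.2.
Proof.
elim: s => [|[u v] s IHs]; first by rewrite big_nil.
by rewrite big_cons -IHs [RHS]tensor_addE.
Qed.

Lemma tensor_sum (x : tensor) : x = \sum_(p <- repr x) pure_tensor p.1 p.2.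
Proof. by rewrite -tensor_piE reprK. Qed.

(* The linear map induced by a bilinear [f]; it only makes sense for such [f]. *)
Definition tensor_lift (W : lmodType K) (f : U -> V -> W) (x : tensor) : W :=
  \sum_(p <- repr x) f p.1 p.2.

Section Lift.
Context (W : lmodType K) (f : U -> V -> W).
Hypothesis f_bilinear : bilinear_for *:%R *:%R f.

Lemma tensor_lift_rel s t : tensor_rel s t ->
  \sum_(p <- s) f p.1 p.2 = \sum_(p <- t) f p.1 p.2.
Proof.
have [fl fr] := f_bilinear.
have f0 v : f 0 v = 0.
  by have /= := fl v (-1) 0 0; rewrite scaler0 addr0 scaleN1r addNr.
have fDl u u' v : f (u + u') v = f u v + f u' v.
  by have /= := fl v 1 u u'; rewrite !scale1r.
have fDr u v v' : f u (v + v') = f u v + f u v'.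
  by have /= := fr u 1 v v'; rewrite !scale1r.
have fZl a u v : f (a *: u) v = a *: f u v.
  by have /= := fl v a u 0; rewrite !addr0 f0 addr0.
have fr0 u : f u 0 = 0.
  by have /= := fr u (-1) 0 0; rewrite scaler0 addr0 scaleN1r addNr.
have fZr a u v : f u (a *: v) = a *: f u v.
  by have /= := fr u a v 0; rewrite !addr0 fr0 addr0.
elim=> {s t} [s|s t _|s t r _ + _|s s' t t' _ + _|s t|v|u u' v|u v v'|a u v] //=.
- by move=> ->.
- by move=> e e'; rewrite !big_cat /= e e'.
- by rewrite !big_cat /= addrC.
- by rewrite big_seq1 big_nil f0.
- by rewrite !big_cons !big_nil /= fDl !addr0.
- by rewrite !big_cons !big_nil /= fDr !addr0.
- by rewrite !big_seq1 /= fZl fZr.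
Qed.

Lemma tensor_lift_pi s : tensor_lift f (pi s) = \sum_(p <- s) f p.1 p.2.
Proof. exact/tensor_lift_rel/tensor_reprP. Qed.

Lemma tensor_lift_pure u v : tensor_lift f (pure_tensor u v) = f u v.
Proof. by rewrite tensor_lift_pi big_seq1. Qed.

Lemma tensor_lift_linear : linear (tensor_lift f).
Proof.
have [fl fr] := f_bilinear.
have f0 v : f 0 v = 0.
  by have /= := fl v (-1) 0 0; rewrite scaler0 addr0 scaleN1r addNr.
move=> a x y; rewrite -[x]reprK -[y]reprK.
rewrite [a *: _]tensor_scaleE [_ + _]tensor_addE !tensor_lift_pi.
rewrite big_cat big_map scaler_sumr; congr (_ + _).
apply: eq_bigr => p _ /=.
by have /= := fl p.2 a p.1 0; rewrite !addr0 f0 addr0.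
Qed.

Lemma tensor_lift_unique (g : tensor -> W) :
  linear g -> (forall u v, g (pure_tensor u v) = f u v) -> g =1 tensor_lift f.
Proof.
move=> g_lin gE x; rewrite [in LHS](tensor_sum x) /tensor_lift.
have g0 : g 0 = 0.
  by have := g_lin (-1) 0 0; rewrite scaler0 addr0 scaleN1r addNr.
elim: (repr x) => [|p s IHs]; first by rewrite !big_nil.
rewrite !big_cons -IHs -gE -[in LHS](scale1r (pure_tensor p.1 p.2)).
by rewrite g_lin scale1r.
Qed.
End Lift.
End Tensor.


(* Norms over R[i] take their values in R[i]; [rnorm x] is the same number
   in R. *)
Definition rnorm (R : realType) (V : normedZmodType R[i]) (x : V) : R :=
  complex.Re `|x|.

Section RnormTheory.
Context (R : realType) (V : normedZmodType R[i]).
Implicit Types x y : V.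

Lemma rnormE x : (rnorm x)%:C%C = `|x|.
Proof. by rewrite RRe_real ?normr_real. Qed.

Lemma rnorm_ge0 x : 0 <= rnorm x.
Proof. by rewrite -lecR rnormE; exact: normr_ge0. Qed.

Lemma rnorm_le x (r : R) : (rnorm x <= r) = (`|x| <= r%:C%C).
Proof. by rewrite -lecR rnormE. Qed.

Lemma rnormD x y : rnorm (x + y) <= rnorm x + rnorm y.
Proof. by rewrite -lecR rmorphD /= !rnormE; exact: ler_normD. Qed.

Lemma rnorm0 : rnorm (0 : V) = 0.
Proof. by rewrite /rnorm normr0. Qed.

Lemma rnormN x : rnorm (- x) = rnorm x.
Proof. by rewrite /rnorm normrN. Qed.
End RnormTheory.

Lemma rnormM (R : realType) (x y : R[i]) : rnorm (x * y) = rnorm x * rnorm y.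
Proof. by apply: (@complexI R); rewrite rmorphM /= !rnormE normrM. Qed.

HB.mixin Record isTopologicalGroup G of Topological G & Group G := {
  mulg_continuous : continuous (fun p : G * G => (p.1 * p.2)%g);
  invg_continuous : continuous (fun x : G => (x^-1)%g)
}.

#[short(type="topologicalGroupType")]
HB.structure Definition TopologicalGroup :=
  {G of Topological G & Group G & isTopologicalGroup G}.

Section Rucb.
Context (R : realType) (G : topologicalGroupType).
Implicit Types f g : G -> R[i]^o.

Definition ltrans (x : G) f : G -> R[i]^o := fun y => f (x * y)%g.

Definition bounded_cfun f := exists M : R, forall y, rnorm (f y) <= M.

Definition sup_norm f : R := sup (range (fun y => rnorm (f y))).

Definition rucb_set : set (G -> R[i]^o) :=
  [set f | bounded_cfun f /\
           sup_norm (ltrans x f - f) @[x --> (1%g : G)] --> (0 : R)].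

Lemma sup_norm_ub f y : bounded_cfun f -> rnorm (f y) <= sup_norm f.
Proof.
move=> [M fM]; apply: ub_le_sup; last by exists y.
by exists M => _ [z _ <-].
Qed.

Lemma sup_norm_le f M : (forall y, rnorm (f y) <= M) -> sup_norm f <= M.
Proof.
move=> fM; apply: ge_sup; last by move=> _ [z _ <-].
by exists (rnorm (f 1%g)), 1%g.
Qed.

Lemma sup_norm_ge0 f : bounded_cfun f -> 0 <= sup_norm f.
Proof. by move=> /(sup_norm_ub 1%g); exact/le_trans/rnorm_ge0. Qed.

Lemma bounded_cfunB f g :
  bounded_cfun f -> bounded_cfun g -> bounded_cfun (f - g).
Proof.
move=> [M fM] [N gN]; exists (M + N) => y.
by rewrite (le_trans (rnormD _ _)) // lerD // rnormN.
Qed.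

Lemma bounded_ltrans x f : bounded_cfun f -> bounded_cfun (ltrans x f).
Proof. by move=> [M fM]; exists M => y; exact: fM. Qed.

Lemma rucbP f : rucb_set f <-> bounded_cfun f /\
  forall e : R, 0 < e ->
    \forall x \near (1%g : G), forall y, rnorm (f (x * y)%g - f y) <= e.
Proof.
split=> -[fb fc]; split=> //.
  move=> e e0; move/cvgrPdist_le: fc => /(_ _ e0); apply: filterS => x.
  rewrite sub0r normrN ger0_norm; last first.
    exact/sup_norm_ge0/bounded_cfunB/fb/bounded_ltrans.
  move=> le_e y; apply: le_trans le_e.
  exact/(@sup_norm_ub (ltrans x f - f))/bounded_cfunB/fb/bounded_ltrans.
apply/cvgrPdist_le => e e0; apply: filterS (fc e e0) => x fx.
rewrite sub0r normrN ger0_norm; first exact: sup_norm_le.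
exact/sup_norm_ge0/bounded_cfunB/fb/bounded_ltrans.
Qed.

Lemma rucb_cst c : rucb_set (fun=> c).
Proof.
apply/rucbP; split; first by exists (rnorm c).
by move=> e e0; apply: nearW => x y; rewrite subrr rnorm0 ltW.
Qed.

Lemma rucb_ltrans x f : rucb_set f -> rucb_set (ltrans x f).
Proof.
move=> /rucbP[fb fc]; apply/rucbP; split; first exact: bounded_ltrans.
move=> e /fc; have conj_cvg : (x * z * x^-1)%g @[z --> (1%g : G)] --> (1%g : G).
  have mul_cvg (u v : G -> G) a b :
      u z @[z --> (1%g : G)] --> a -> v z @[z --> (1%g : G)] --> b ->
      (u z * v z)%g @[z --> (1%g : G)] --> (a * b)%g.
    move=> ua vb.
    apply: (cvg_comp (fun z => (u z, v z)) (fun p : G * G => (p.1 * p.2)%g)).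
      exact: cvg_pair ua vb.
    exact: (mulg_continuous (a, b)).
  have := mul_cvg _ _ _ _ (mul_cvg _ _ _ _ (cvg_cst x) cvg_id) (cvg_cst x^-1%g).
  by rewrite mulg1 mulgV; apply; exact: nbhs_filter.
move=> /conj_cvg; apply: (@filterS _ (nbhs (1%g : G))) => z /= fz y.
by have := fz (x * y)%g; rewrite /ltrans !mulgA mulgVK.
Qed.

Definition rucb_pred : {pred (G -> R[i]^o)} := mem rucb_set.

Lemma rucb_submod_closed : submod_closed rucb_pred.
Proof.
split; first by rewrite inE; exact: rucb_cst.
move=> a f g /[!inE] /rucbP[[M fM] fc] /rucbP[[N gN] gc]; apply/rucbP; split.
  exists (rnorm a * M + N) => y; rewrite (le_trans (rnormD _ _)) // lerD //.
  by rewrite [a *: f]/(_ *: _) /= rnormM ler_wpM2l // rnorm_ge0.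
move=> e e0.
have a0 : 0 < rnorm a + 1 by rewrite ltr_wpDl // rnorm_ge0.
have e1 : 0 < e / 2 / (rnorm a + 1) by rewrite !divr_gt0.
have e2 : 0 < e / 2 by rewrite divr_gt0.
apply: filterS2 (fc _ e1) (gc _ e2) => x fx gx y.
have -> : (a *: f + g) (x * y)%g - (a *: f + g) y =
    a * (f (x * y)%g - f y) + (g (x * y)%g - g y).
  by rewrite mulrBr opprD addrACA.
rewrite (le_trans (rnormD _ _)) // [leRHS]splitr lerD // rnormM.
rewrite (le_trans (ler_wpM2l (rnorm_ge0 _) (fx y))) // mulrCA ler_piMr ?ltW //.
by rewrite ltr_pdivrMr // mul1r ltrDl.
Qed.

HB.instance Definition _ :=
  GRing.isSubmodClosed.Build R[i] (G -> R[i]^o) rucb_pred rucb_submod_closed.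
End Rucb.

Section Amenable.
Context (R : realType) (G : topologicalGroupType).

Record rucb := Rucb {
  rucb_val :> G -> R[i]^o;
  rucb_valP : rucb_val \in @rucb_pred R G }.

HB.instance Definition _ := [isSub for rucb_val].
HB.instance Definition _ := [Choice of rucb by <:].
HB.instance Definition _ := [SubChoice_isSubLmodule of rucb by <:].

Definition rucb_one : rucb := Rucb (mem_set (@rucb_cst R G 1)).

Definition rucb_trans (x : G) (f : rucb) : rucb :=
  Rucb (mem_set (rucb_ltrans x (set_mem (rucb_valP f)))).

(* The operator norm with respect to the sup norm; it is +oo exactly when [mu]
   is unbounded, so a finite value places [mu] in the dual of [rucb]. *)
Definition dual_norm (mu : {scalar rucb}) : \bar R :=
  ereal_sup [set (rnorm (mu f))%:E | f in [set f : rucb | sup_norm f <= 1]].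

Definition amenable : Prop :=
  exists mu : {scalar rucb},
    [/\ mu rucb_one = 1, dual_norm mu = 1%E &
        forall x f, mu (rucb_trans x f) = mu f].
End Amenable.

(* The multiplication is a field of the mixin because a join of pzRingType and
   completeNormedModType would have to be declared before numDomainType. The
   zero algebra is allowed. *)
HB.mixin Record isCstarAlgebra (R : realType) A
    of CompleteNormedModule R[i] A := {
  cmul : A -> A -> A;
  cone : A;
  star : A -> A;
  cmulA : associative cmul;
  cmul1 : left_id cone cmul;
  cmulr1 : right_id cone cmul;
  cmulDl : left_distributive cmul +%R;
  cmulDr : right_distributive cmul +%R;
  cmulZl : forall (a : R[i]) x y, cmul (a *: x) y = a *: cmul x y;
  cmulZr : forall (a : R[i]) x y, cmul x (a *: y) = a *: cmul x y;
  starK : involutive star;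
  starD : {morph star : x y / x + y};
  starZ : forall (a : R[i]) x, star (a *: x) = a^* *: star x;
  starM : forall x y, star (cmul x y) = cmul (star y) (star x);
  cnormM : forall x y, `|cmul x y| <= `|x| * `|y|;
  cnorm_star : forall x, `|cmul (star x) x| = `|x| ^+ 2
}.

#[short(type="cstarAlgType")]
HB.structure Definition CstarAlgebra (R : realType) :=
  {A of CompleteNormedModule R[i] A & isCstarAlgebra R A}.

Arguments cone {R} A : rename.

Section UnitaryGroup.
Context (R : realType) (A : cstarAlgType R).
Local Notation "x ** y" := (cmul x y) (at level 40, left associativity).
Local Notation "1" := (cone A).

Definition unitaries : set A :=
  [set u | star u ** u = 1 /\ u ** star u = 1].

Lemma star1 : star 1 = 1.
Proof. by rewrite -[LHS]cmul1 -{1}(starK 1) -starM cmul1 starK. Qed.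

Lemma unitary1 : unitaries 1.
Proof. by split; rewrite star1 cmul1. Qed.

Lemma unitaryM u v : unitaries u -> unitaries v -> unitaries (u ** v).
Proof.
move=> [uu uu'] [vv vv']; split; rewrite starM.
  by rewrite cmulA -[_ ** u]cmulA uu cmulr1.
by rewrite cmulA -[_ ** star v]cmulA vv' cmulr1.
Qed.

Lemma unitary_star u : unitaries u -> unitaries (star u).
Proof. by case=> uu uu'; split; rewrite starK. Qed.

(* [set_type] carries the subspace topology, here the norm topology. *)
Definition unitary_group : Type := set_type unitaries.

HB.instance Definition _ := Choice.on unitary_group.
HB.instance Definition _ :=
  Topological.copy unitary_group (set_type unitaries).

Definition unitary_one : unitary_group := SigSub (mem_set unitary1).
Definition unitary_mul (u v : unitary_group) : unitary_group :=
  SigSub (mem_set (unitaryM (set_mem (valP u)) (set_mem (valP v)))).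
Definition unitary_inv (u : unitary_group) : unitary_group :=
  SigSub (mem_set (unitary_star (set_mem (valP u)))).

Lemma unitary_mulA : associative unitary_mul.
Proof. by move=> u v w; apply: val_inj; rewrite /= cmulA. Qed.

Lemma unitary_mul1 : left_id unitary_one unitary_mul.
Proof. by move=> u; apply: val_inj; rewrite /= cmul1. Qed.

Lemma unitary_mulr1 : right_id unitary_one unitary_mul.
Proof. by move=> u; apply: val_inj; rewrite /= cmulr1. Qed.

Lemma unitary_mulV : left_inverse unitary_one unitary_inv unitary_mul.
Proof.
by move=> u; apply: val_inj; case: (set_mem (valP u)).
Qed.

Lemma unitary_mulrV : right_inverse unitary_one unitary_inv unitary_mul.
Proof.
by move=> u; apply: val_inj; case: (set_mem (valP u)).
Qed.

HB.instance Definition _ := isGroup.Build unitary_group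
  unitary_mulA unitary_mul1 unitary_mulr1 unitary_mulV unitary_mulrV.

Lemma cnorm_star_le (x : A) : `|x| <= `|star x|.
Proof.
have [->|x0] := eqVneq x 0; first by rewrite normr0.
by rewrite -(@ler_pM2r _ `|x|) ?normr_gt0 // -expr2 -cnorm_star cnormM.
Qed.

Lemma normr_star (x : A) : `|star x| = `|x|.
Proof.
by apply/le_anti; rewrite cnorm_star_le -{2}(starK x) cnorm_star_le.
Qed.

Lemma norm_unitary_le (u : A) : unitaries u -> `|u| <= 1%R.
Proof.
move=> [uu _]; have := cnorm_star u; rewrite uu => n1.
have := cnorm_star 1; rewrite star1 cmul1 => /eqP.
rewrite -subr_eq0 expr2 -{1}[`|1|]mul1r -mulrBl mulf_eq0 => /orP[|/eqP n0].
  rewrite subr_eq0 => /eqP n1'; move/eqP: n1; rewrite -n1'.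
  by rewrite eq_sym sqrp_eq1 // => /eqP ->.
by move/esym/eqP: n1; rewrite n0 sqrf_eq0 => /eqP ->.
Qed.

Lemma starB (x y : A) : star (x - y) = star x - star y.
Proof. by rewrite starD -scaleN1r starZ rmorphN1 scaleN1r. Qed.

Lemma unitary_inv_continuous : continuous unitary_inv.
Proof.
apply: continuous_comp_initial => u.
apply: (cvg_comp (fun v : unitary_group => val v) (@star R A)).
  exact: initial_continuous.
apply/cvgrPdist_lt => e e0.
have := nbhsx_ballx (val u : A) e e0; rewrite -ball_normE.
by apply: filterS => x /=; rewrite -starB normr_star.
Qed.

Lemma unitary_mul_continuous :
  continuous (fun p : unitary_group * unitary_group => unitary_mul p.1 p.2).
Proof.
apply: continuous_comp_initial => -[u v].
apply/cvgrPdist_lt => e e0; have e2 : 0 < e / 2 by rewrite divr_gt0.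
have val_cvg (w : unitary_group) :
    \forall x \near w, `|(val w : A) - val x| < e / 2.
  have := @initial_continuous unitary_group A val w.
  by move/cvgrPdist_lt => /(_ _ e2).
exists ([set x | `|(val u : A) - val x| < e / 2],
        [set y | `|(val v : A) - val y| < e / 2]).
  by split; exact: val_cvg.
move=> -[x y] [/= ux vy].
have -> : (val u : A) ** val v - val x ** val y =
    (val u - val x) ** val v + val x ** (val v - val y).
  rewrite cmulDl cmulDr -[- val x]scaleN1r -[- val y]scaleN1r.
  rewrite cmulZl cmulZr !scaleN1r.
  by rewrite addrA subrK.
rewrite (le_lt_trans (ler_normD _ _)) // [ltRHS]splitr ltrD //.
  rewrite (le_lt_trans (cnormM _ _)) // (le_lt_trans _ ux) //.
  by rewrite ler_piMr // norm_unitary_le //; exact/set_mem/(valP v).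
rewrite (le_lt_trans (cnormM _ _)) // (le_lt_trans _ vy) //.
by rewrite ler_piMl // norm_unitary_le //; exact/set_mem/(valP x).
Qed.

HB.instance Definition _ := isTopologicalGroup.Build unitary_group
  unitary_mul_continuous unitary_inv_continuous.
End UnitaryGroup.

Section ProjectiveTensor.
Context (R : realType) (A : cstarAlgType R).
Local Notation C := R[i].
Local Notation AA := (tensor A A).

(* The infimum is over all representations of [t] as a sum of elementary
   tensors. *)
Definition proj_norm (t : AA) : R :=
  inf [set r | exists2 s : seq (A * A),
    t = \sum_(p <- s) pure_tensor p.1 p.2 &
    r = \sum_(p <- s) rnorm p.1 * rnorm p.2].

Definition tensor_mult : AA -> A := tensor_lift (@cmul R A).

Definition tensor_lact (a : A) : AA -> AA :=
  tensor_lift (fun x y => pure_tensor (cmul a x) y).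

Definition tensor_ract (a : A) : AA -> AA :=
  tensor_lift (fun x y => pure_tensor x (cmul y a)).

Definition tensor_flip : AA -> AA := tensor_lift (fun x y => pure_tensor y x).

Lemma tensor_mult_bilinear : bilinear_for *:%R *:%R (@cmul R A).
Proof.
by split=> [y|x] a u v /=; rewrite ?(cmulDl, cmulDr) ?(cmulZl, cmulZr).
Qed.

Lemma tensor_lact_bilinear a :
  bilinear_for *:%R *:%R (fun x y : A => pure_tensor (cmul a x) y).
Proof.
split=> [y|x] c u v /=; last by rewrite pure_tensorDr pure_tensorZr.
by rewrite cmulDr cmulZr pure_tensorDl pure_tensorZl.
Qed.

Lemma tensor_ract_bilinear a :
  bilinear_for *:%R *:%R (fun x y : A => pure_tensor x (cmul y a)).
Proof.
split=> [y|x] c u v /=; first by rewrite pure_tensorDl pure_tensorZl.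
by rewrite cmulDl cmulZl pure_tensorDr pure_tensorZr.
Qed.

Lemma tensor_flip_bilinear :
  bilinear_for *:%R *:%R (fun x y : A => pure_tensor y x).
Proof.
by split=> [y|x] c u v /=;
  rewrite ?(pure_tensorDl, pure_tensorDr) ?(pure_tensorZl, pure_tensorZr).
Qed.

Lemma tensor_mult_pure (x y : A) : tensor_mult (pure_tensor x y) = cmul x y.
Proof. exact/tensor_lift_pure/tensor_mult_bilinear. Qed.

Lemma tensor_lact_pure (a x y : A) :
  tensor_lact a (pure_tensor x y) = pure_tensor (cmul a x) y.
Proof.
by rewrite /tensor_lact tensor_lift_pure //; exact: tensor_lact_bilinear.
Qed.

Lemma tensor_ract_pure (a x y : A) :
  tensor_ract a (pure_tensor x y) = pure_tensor x (cmul y a).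
Proof.
by rewrite /tensor_ract tensor_lift_pure //; exact: tensor_ract_bilinear.
Qed.

Lemma tensor_flip_pure (x y : A) :
  tensor_flip (pure_tensor x y) = pure_tensor y x.
Proof.
by rewrite /tensor_flip tensor_lift_pure //; exact: tensor_flip_bilinear.
Qed.

HB.instance Definition _ := GRing.isLinear.Build C AA A *:%R tensor_mult
  (tensor_lift_linear tensor_mult_bilinear).
HB.instance Definition _ a := GRing.isLinear.Build C AA AA *:%R (tensor_lact a)
  (tensor_lift_linear (tensor_lact_bilinear a)).
HB.instance Definition _ a := GRing.isLinear.Build C AA AA *:%R (tensor_ract a)
  (tensor_lift_linear (tensor_ract_bilinear a)).
HB.instance Definition _ := GRing.isLinear.Build C AA AA *:%R tensor_flip
  (tensor_lift_linear tensor_flip_bilinear).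
End ProjectiveTensor.

Definition directed (I : Type) (le : I -> I -> Prop) : Prop :=
  [/\ inhabited I, forall i, le i i,
      forall i j k, le i j -> le j k -> le i k &
      forall i j, exists k, le i k /\ le j k].

(* The filter of tails, along which a net indexed by [I] converges. *)
Definition tails (I : Type) (le : I -> I -> Prop) : set_system I :=
  filter_from setT (fun i => [set j | le i j]).

Definition convex_hull (K : numDomainType) (V : lmodType K) (S : set V) : set V :=
  \bigcap_(C in [set C : set (convex_lmodType V) | convex_set C /\ S `<=` C]) C.

Section StrongAmenability.
Context (R : realType) (A : cstarAlgType R).

Definition approximate_unit (I : Type) (le : I -> I -> Prop) (e : I -> A) :=
  forall a : A, cmul (e i) a @[i --> tails le] --> a /\
                cmul a (e i) @[i --> tails le] --> a.

Definition approximate_diagonal (I : Type) (le : I -> I -> Prop)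
    (Delta : I -> tensor A A) :=
  [/\ exists M : R, forall i, proj_norm (Delta i) <= M,
      approximate_unit le (fun i => tensor_mult (Delta i)) &
      forall a : A,
        proj_norm (tensor_lact a (Delta i) - tensor_ract a (Delta i))
          @[i --> tails le] --> (0 : R)].

Definition strongly_amenable : Prop :=
  exists (I : Type) (le : I -> I -> Prop) (Delta : I -> tensor A A),
    [/\ directed le, approximate_diagonal le Delta,
        forall i, tensor_flip (Delta i) = Delta i &
        forall i, convex_hull
          [set pure_tensor (star u) u | u in @unitaries R A] (Delta i)].
End StrongAmenability.

(* Main.v *)
(* Write [d u] for [u (x) u^*]. For a bounded additive functional [f] on [A (x) A],
   the function [u |-> f (d u)] lies in RUCB, and invariance of the mean [mu] gives
   that [u |-> f (v (d u) - (d u) v)] has mean zero for every unitary [v]. The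
   elements of [A] with this property form a subspace closed under inverses, hence
   all of [A]: a small skew-adjoint [x] is recovered from its Cayley transform.
   By Hahn-Banach, for any finitely many elements of [A] some average of the [d u]
   therefore almost commutes with all of them. Replacing an average of the
   [u_i (x) u_i^*] by that of the [u_i u_j^* (x) u_j u_i^*] makes it symmetric. *)
Require Import Defs.
From HB Require Import structures.
From mathcomp Require Import all_boot all_order all_algebra.
From mathcomp Require Import all_classical all_reals all_analysis.
From mathcomp Require Import complex lra.

Set Implicit Arguments.
Unset Strict Implicit.
Unset Printing Implicit Defensive.

Import Order.TTheory GRing.Theory Num.Theory.
Import numFieldNormedType.Exports.

Local Open Scope classical_set_scope.
Local Open Scope ring_scope.

(** * Subadditivity of infima *)

Section Infimum.
Context (R : realType).
Implicit Types A B C : set R.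

(** Serves the functionals below that are defined as infima: their subadditivity is reduced to a
    choice of members. *)
Lemma inf_le_add A B C : A !=set0 -> B !=set0 -> has_lbound C ->
  (forall a b, A a -> B b -> exists2 c, C c & c <= a + b) ->
  inf C <= inf A + inf B.
Proof.
move=> A0 B0 Clb ABC; rewrite -lerBlDr; apply: lb_le_inf => // a Aa.
rewrite lerBlDr -lerBlDl; apply: lb_le_inf => // b Bb.
by rewrite lerBlDl; have [c Cc] := ABC _ _ Aa Bb; apply: le_trans; exact: ge_inf.
Qed.
End Infimum.

(** * The Hahn-Banach theorem on abelian groups *)

Section HahnBanach.
Context (R : realType) (V : zmodType).
Implicit Types (p q : V -> R) (x y : V).

(* Homogeneity is only required for integral multiples, so that everything works
   over an abelian group; the other inequality follows from subadditivity. *)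
Definition sublinear p :=
  (forall x y, p (x + y) <= p x + p y) /\
  (forall n x, p x *+ n <= p (x *+ n)).

Lemma sublinear0 p : sublinear p -> p 0 = 0.
Proof.
move=> [_ pM]; have := pM 0%N 0; have := pM 2%N 0.
rewrite mul0rn mulr0n mulr2n -lerBrDr subrr => ? ?; exact/le_anti/andP.
Qed.

Lemma sublinearMn p n x : sublinear p -> p (x *+ n) = p x *+ n.
Proof.
move=> sp; apply/le_anti; rewrite (proj2 sp) andbT.
elim: n => [|n IHn]; first by rewrite !mulr0n sublinear0.
by rewrite !mulrS (le_trans (proj1 sp _ _)) // lerD2l.
Qed.

Lemma sublinearN p x : sublinear p -> - p (- x) <= p x.
Proof.
move=> sp; rewrite lerNl -subr_ge0 opprK -(sublinear0 sp) -(subrr (- x)) opprK.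
by rewrite (proj1 sp).
Qed.

(** Provides the bound of a chain for Zorn's lemma. The infima are finite because every member is at
    least [- p (- x)], and of two members of the chain the smaller one serves both terms of a
    sum. *)
Lemma sublinear_chain_inf (F : set (V -> R)) p :
  F !=set0 -> (forall q, F q -> sublinear q /\ forall x, q x <= p x) ->
  total_on F (fun q r => forall x, r x <= q x) ->
  sublinear (fun x => inf [set q x | q in F]).
Proof.
move=> [q0 Fq0] Fp Ftot.
have F0 x : [set q x | q in F] !=set0 by exists (q0 x), q0.
have Flb x : has_lbound [set q x | q in F].
  exists (- p (- x)) => _ [q /Fp[sq qp] <-].
  by rewrite (le_trans _ (sublinearN x sq)) // lerN2.
split=> [x y|n x].
  apply: inf_le_add => // _ _ [q Fq <-] [r Fr <-].
  have [qr|rq] := Ftot _ _ Fq Fr.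
    exists (r (x + y)); first by exists r.
    by rewrite (le_trans (proj1 (proj1 (Fp _ Fr)) _ _)) // lerD2r.
  exists (q (x + y)); first by exists q.
  by rewrite (le_trans (proj1 (proj1 (Fp _ Fq)) _ _)) // lerD2l.
apply: lb_le_inf => // _ [q Fq <-]; rewrite (sublinearMn _ _ (proj1 (Fp _ Fq))).
by rewrite lerMn2r; apply/orP; right; apply: ge_inf => //; exists q.
Qed.

Lemma sublinear_minimal p : sublinear p -> exists q,
  [/\ sublinear q, forall x, q x <= p x &
      forall r, sublinear r -> (forall x, r x <= q x) -> r = q].
Proof.
move=> sp; pose P q := sublinear q /\ forall x, q x <= p x; pose T := {q | P q}.
(* The pointwise order is reversed, so that a maximal element in Zorn's lemma is a minimal
   functional. *)
pose le (q r : T) := `[< forall x, sval r x <= sval q x >].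
have [| | |A Atot|[q [sq qp]] qmin] := @Zorn T le.
- by move=> q; apply/asboolP.
- move=> q r t /asboolP qr /asboolP rt; apply/asboolP => x.
  exact: le_trans (rt x) (qr x).
- move=> [q Pq] [r Pr] /asboolP /= qr /asboolP /= rq; apply: eq_exist.
  by apply/funext => x; apply/le_anti/andP.
- have [A0|/set0P[[q0 Pq0] Aq0]] := eqVneq A set0.
    by exists (exist P p (conj sp (fun x => lexx _))) => s; rewrite A0.
  pose F := [set sval q | q in A].
  have FA q : F q -> sublinear q /\ forall x, q x <= p x.
    by move=> [[r Pr] _ <-].
  have Fs : sublinear (fun x => inf [set q x | q in F]).
    apply: (@sublinear_chain_inf _ p) => //; first by exists q0, (exist P q0 Pq0).
    move=> _ _ [q Aq <-] [r Ar <-].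
    by have [/asboolP|/asboolP] := Atot _ _ Aq Ar; [left|right].
  have Fle q : F q -> forall x, inf [set q x | q in F] <= q x.
    move=> Fq x; apply: ge_inf; last by exists q.
    exists (- p (- x)) => _ [r /FA[sr rp] <-].
    by rewrite (le_trans _ (sublinearN x sr)) // lerN2.
  have Fp x : inf [set q x | q in F] <= p x.
    apply: le_trans (proj2 Pq0 x); apply: Fle.
    by exists (exist P q0 Pq0).
  exists (exist P _ (conj Fs Fp)) => q Aq.
  by apply/asboolP => x /=; apply: Fle; exists q.
exists q; split=> // r sr rq.
have rp x : r x <= p x by exact: le_trans (rq x) (qp x).
suff /(congr1 sval) : exist P r (conj sr rp) = exist P q (conj sq qp) by [].
by apply: qmin; exact/asboolP.
Qed.

Lemma sublinear_minimal_additive q : sublinear q ->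
  (forall r, sublinear r -> (forall x, r x <= q x) -> r = q) ->
  {morph q : x y / x + y}.
Proof.
move=> sq qmin x y; apply/le_anti; rewrite (proj1 sq) /=.
(* [r] is sublinear and below [q], hence equal to [q] by minimality, while
   [r x <= q (x + y) - q y]. *)
pose E z := range (fun n => q (z + y *+ n) - q y *+ n).
pose r z := inf (E z).
have E0 z : E z !=set0 by exists (q (z + y *+ 0) - q y *+ 0), 0%N.
have Elb z : has_lbound (E z).
  exists (- q (- z)) => _ [n _ <-].
  rewrite lerBrDl -sublinearMn // lerBlDr (le_trans _ (proj1 sq _ _)) //.
  by rewrite addrAC subrr add0r.
have rq : r = q; last first.
  by rewrite -lerBrDr -{1}rq; apply: ge_inf => //; exists 1%N.
apply: qmin => [|z]; last first.
  by apply: ge_inf => //; exists 0%N => //; rewrite !mulr0n subr0 addr0.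
split=> [z w|m z].
  apply: inf_le_add => // _ _ [m _ <-] [n _ <-].
  exists (q (z + w + y *+ (m + n)) - q y *+ (m + n)); first by exists (m + n)%N.
  rewrite !mulrnDr opprD [leRHS]addrACA lerD2r (le_trans _ (proj1 sq _ _)) //.
  by rewrite addrACA.
apply: lb_le_inf => // _ [n _ <-].
have [->|m0] := eqVneq m 0%N.
  by rewrite !mulr0n add0r sublinearMn // subrr.
(* The member of [E z] with the same [n] is multiplied by [m]. This produces [y *+ (n * m)] instead
   of [y *+ n]; subadditivity of [q] absorbs the surplus [y *+ (n * m.-1)]. *)
apply: (@le_trans _ _ ((q (z + y *+ n) - q y *+ n) *+ m)).
  by rewrite lerMn2r (negPf m0); apply: ge_inf => //; exists n.
rewrite mulrnBl -(sublinearMn m (z + y *+ n) sq) mulrnDl -!mulrnA.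
have nmE (W : zmodType) (w : W) : w *+ (n * m) = w *+ n + w *+ (n * m.-1).
  by rewrite -mulrnDr -mulnS prednK // lt0n.
rewrite lerBlDr !nmE !addrA subrK -(sublinearMn (n * m.-1) y sq).
exact: (proj1 sq).
Qed.

Theorem hahn_banach p : sublinear p ->
  exists2 q : V -> R, {morph q : x y / x + y} & forall x, q x <= p x.
Proof.
move=> /sublinear_minimal[q [sq qp qmin]]; exists q => //.
exact: sublinear_minimal_additive.
Qed.
End HahnBanach.

Lemma mulrDl_div_nat (F : numFieldType) (x y : F) (m n : nat) :
  (0 < m)%N -> (0 < n)%N ->
  (x / m%:R + y / n%:R) * (m * n)%:R = x *+ n + y *+ m.
Proof.
move=> m0 n0; rewrite -(mulr_natr x) -(mulr_natr y) natrM.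
have : m%:R != 0 :> F by rewrite pnatr_eq0 -lt0n.
have : n%:R != 0 :> F by rewrite pnatr_eq0 -lt0n.
move: m%:R n%:R => a b b0 a0.
by rewrite mulrDl -!mulrA mulKf // [b^-1 * _]mulrC -!mulrA mulfV // mulr1.
Qed.

(** * A sandwich theorem for a submonoid of [V * R] *)

Section Separation.
Context (R : realType) (V : zmodType) (N : V -> R) (K : set (V * R)).
Hypotheses (N_sublinear : sublinear N) (K0 : K 0)
  (KD : forall k l, K k -> K l -> K (k + l)).

Lemma additive_separation : (forall k, K k -> k.2 <= N k.1) ->
  exists q : V -> R, [/\ {morph q : x y / x + y}, forall x, q x <= N x &
    forall k, K k -> k.2 <= q k.1].
Proof.
move=> KN; have KM m k : K k -> K (k *+ m).
  by move=> Kk; elim: m => // m IHm; rewrite mulrS; exact: KD.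
(* Any admissible [q] satisfies [q x <= v x m k]: its value at [x *+ m.+1 + k.1] is at most that of
   [N], and [k.2 <= q k.1]. *)
pose v x m k : R := (N (x *+ m.+1 + k.1) - k.2) / m.+1%:R.
pose E x := [set t | exists m, exists2 k, K k & t = v x m k].
have E0 x : E x !=set0 by exists (v x 0%N 0), 0%N, 0.
have Elb x : has_lbound (E x).
  exists (- N (- x)) => _ [m [k Kk ->]].
  rewrite ler_pdivlMr ?ltr0Sn // mulNr mulr_natr -sublinearMn // lerBrDr.
  rewrite addrC lerBlDr (le_trans (KN _ Kk)) //.
  rewrite (le_trans _ (proj1 N_sublinear _ _)) //.
  by rewrite mulNrn addrAC subrr add0r.
(* An additive map below [p] is below [N] (take [k = 0]), and its value at
   [- k.1] is at most [- k.2] (take [m = 0]). *)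
pose p x := inf (E x).
have sp : sublinear p.
  split=> [x y|n x].
    apply: inf_le_add => // _ _ [m [k Kk ->]] [n [l Kl ->]].
    (* The fractions are put over the common denominator [m.+1 * n.+1]; the predecessor offsets the
       successor built into [v]. *)
    exists (v (x + y) (m.+1 * n.+1).-1 (k *+ n.+1 + l *+ m.+1)).
      by exists (m.+1 * n.+1).-1, (k *+ n.+1 + l *+ m.+1) => //; apply: KD; exact: KM.
    rewrite /v prednK ?muln_gt0 // ler_pdivrMr ?ltr0n ?muln_gt0 //.
    rewrite mulrDl_div_nat //.
    rewrite !mulrnBl addrACA -opprD.
    have -> : (k *+ n.+1 + l *+ m.+1).2 = k.2 *+ n.+1 + l.2 *+ m.+1.
      by rewrite /= !raddfMn.
    rewrite lerD2r -!sublinearMn // (le_trans _ (proj1 N_sublinear _ _)) //.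
    rewrite mulrnDl !mulrnDl -!mulrnA [(n.+1 * m.+1)%N]mulnC addrACA.
    by rewrite /= !raddfMn.
  apply: lb_le_inf => // _ [m [k Kk ->]].
  have [->|n0] := eqVneq n 0%N.
    by rewrite mulr0n mulr0n /v mul0rn add0r divr_ge0 // subr_ge0 KN.
  rewrite -mulr_natr -ler_pdivlMr ?ltr0n ?lt0n //; apply: ge_inf => //.
  exists (n * m.+1).-1, k => //; rewrite /v -mulrA -invfM -natrM.
  by rewrite [(_ * n)%N]mulnC prednK ?muln_gt0 ?lt0n ?n0 // -mulrnA.
have [q qD qp] := hahn_banach sp; exists q; split=> // [x|k Kk].
  apply: le_trans (qp x) _; apply: ge_inf => //; exists 0%N, 0 => //.
  by rewrite /v mulr1n addr0 subr0 divr1.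
have q0 : q 0 = 0 by apply: (addrI (q 0)); rewrite -qD !addr0.
have -> : q k.1 = - q (- k.1).
  by apply/eqP; rewrite -subr_eq0 opprK -qD subrr q0.
rewrite lerNr; apply: le_trans (qp _) _; apply: ge_inf => //.
exists 0%N, k => //; rewrite /v mulr1n addNr sublinear0 // divr1 add0r //.
Qed.
End Separation.

(** * The projective norm and maps bounded for it *)

Section ProjectiveNorm.
Context (R : realType) (A : cstarAlgType R).
Implicit Types (x y : A) (t : tensor A A).

Lemma rnorm_scale (V : normedModType R[i]) (a : R[i]) (v : V) :
  rnorm (a *: v) = rnorm a * rnorm v.
Proof. by apply: (@complexI R); rewrite rmorphM /= !rnormE normrZ. Qed.

Lemma rnorm_real (r : R) : 0 <= r -> rnorm (r%:C%C : R[i]) = r.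
Proof. by move=> r0; apply: (@complexI R); rewrite rnormE ger0_norm ?ler0c. Qed.

Lemma rnorm_cmul x y : rnorm (cmul x y) <= rnorm x * rnorm y.
Proof. by rewrite -lecR rmorphM /= !rnormE cnormM. Qed.

Lemma rnorm_unitary x : unitaries x -> rnorm x <= 1.
Proof. by move=> /norm_unitary_le; rewrite -lecR rnormE. Qed.

Local Notation rep_norms t := [set r | exists2 s : seq (A * A),
  t = \sum_(p <- s) pure_tensor p.1 p.2 &
  r = \sum_(p <- s) rnorm p.1 * rnorm p.2].

Lemma rep_norms_neq0 t : rep_norms t !=set0.
Proof.
exists (\sum_(p <- repr t) rnorm p.1 * rnorm p.2), (repr t) => //.
exact: tensor_sum.
Qed.

Lemma rep_norms_lb t : has_lbound (rep_norms t).
Proof. by exists 0 => _ [s _ ->]; apply: sumr_ge0 => p _; rewrite mulr_ge0 ?rnorm_ge0. Qed.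

Lemma proj_norm_ge0 t : 0 <= proj_norm t.
Proof.
apply: lb_le_inf; first exact: rep_norms_neq0.
by move=> _ [s _ ->]; apply: sumr_ge0 => p _; rewrite mulr_ge0 ?rnorm_ge0.
Qed.

Lemma proj_norm_sum_pure (s : seq (A * A)) :
  proj_norm (\sum_(p <- s) pure_tensor p.1 p.2) <=
  \sum_(p <- s) rnorm p.1 * rnorm p.2.
Proof. by apply: ge_inf; [exact: rep_norms_lb | exists s]. Qed.

Lemma proj_norm_pure x y : proj_norm (pure_tensor x y) <= rnorm x * rnorm y.
Proof. by have := proj_norm_sum_pure [:: (x, y)]; rewrite !big_seq1. Qed.

Lemma proj_normD t1 t2 : proj_norm (t1 + t2) <= proj_norm t1 + proj_norm t2.
Proof.
apply: inf_le_add; [exact: rep_norms_neq0|exact: rep_norms_neq0|exact: rep_norms_lb|].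
move=> _ _ [s -> ->] [s' -> ->]; eexists; last exact: lexx.
by exists (s ++ s'); rewrite big_cat.
Qed.

Lemma proj_norm0 : proj_norm (0 : tensor A A) = 0.
Proof.
apply/le_anti; rewrite proj_norm_ge0 andbT.
by have := proj_norm_sum_pure [::]; rewrite !big_nil.
Qed.

Lemma proj_norm_sum (I : Type) (r : seq I) (F : I -> tensor A A) :
  proj_norm (\sum_(i <- r) F i) <= \sum_(i <- r) proj_norm (F i).
Proof.
elim/big_ind2: _ => [|t m t' m' tm tm'|//]; first by rewrite proj_norm0.
by rewrite (le_trans (proj_normD _ _)) // lerD.
Qed.

(** The norm is an infimum over representations by elementary tensors, so a bound on these passes to
    each representation and then to the infimum. *)
Lemma proj_norm_morphism (f : tensor A A -> tensor A A) (c : R) :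
    0 <= c -> nmod_morphism f ->
    (forall x y, proj_norm (f (pure_tensor x y)) <= c * (rnorm x * rnorm y)) ->
  forall t, proj_norm (f t) <= c * proj_norm t.
Proof.
move=> c0 [f0 fD] fpure t.
suff bound (s : seq (A * A)) :
    proj_norm (f (\sum_(p <- s) pure_tensor p.1 p.2)) <=
    c * \sum_(p <- s) rnorm p.1 * rnorm p.2.
  (* The infimum is reached after dividing by [c]; for [c = 0] a single representation suffices. *)
  have [c00|cn0] := eqVneq c 0.
    by rewrite {1}(tensor_sum t) (le_trans (bound _)) // c00 !mul0r.
  have cpos : 0 < c by rewrite lt_neqAle eq_sym cn0.
  rewrite -ler_pdivrMl //; apply: lb_le_inf; first exact: rep_norms_neq0.
  by move=> _ [s -> ->]; rewrite ler_pdivrMl.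
elim: s => [|p s IHs]; first by rewrite !big_nil f0 proj_norm0 mulr0.
rewrite !big_cons fD mulrDr (le_trans (proj_normD _ _)) // lerD //.
Qed.

Lemma proj_norm_scale (a : R[i]) t : proj_norm (a *: t) <= rnorm a * proj_norm t.
Proof.
apply: (@proj_norm_morphism ( *:%R a)); first exact: rnorm_ge0.
  by split=> [|u v]; rewrite ?scaler0 ?scalerDr.
move=> x y; rewrite -pure_tensorZl (le_trans (proj_norm_pure _ _)) //.
by rewrite rnorm_scale mulrA.
Qed.

Lemma proj_normN t : proj_norm (- t) = proj_norm t.
Proof.
have leN (u : tensor A A) : proj_norm (- u) <= proj_norm u.
  rewrite -(scaleN1r u) (le_trans (proj_norm_scale _ _)) // rnormN.
  by rewrite (rnorm_real ler01) mul1r.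
by apply/le_anti; rewrite leN -{1}(opprK t) leN.
Qed.

Lemma proj_norm_sublinear : sublinear (@proj_norm R A).
Proof.
split=> [|n t]; first exact: proj_normD.
have [->|n0] := eqVneq n 0%N; first by rewrite !mulr0n proj_norm_ge0.
rewrite -mulr_natl -ler_pdivlMl ?ltr0n ?lt0n //.
have {1}-> : t = (n%:R^-1)%:C%C *: (t *+ n).
  rewrite -(scaler_nat n t) scalerA -(rmorph_nat (real_complex R)) -rmorphM /=.
  by rewrite mulVf ?pnatr_eq0 // scale1r.
by rewrite (le_trans (proj_norm_scale _ _)) // rnorm_real // invr_ge0 ler0n.
Qed.

Lemma proj_norm_lact (a : A) t :
  proj_norm (tensor_lact a t) <= rnorm a * proj_norm t.
Proof.
apply: proj_norm_morphism; first exact: rnorm_ge0.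
  by split=> [|u v]; rewrite ?raddf0 ?raddfD.
move=> x y; rewrite tensor_lact_pure (le_trans (proj_norm_pure _ _)) //.
by rewrite mulrA ler_wpM2r ?rnorm_ge0 // rnorm_cmul.
Qed.

Lemma proj_norm_ract (a : A) t :
  proj_norm (tensor_ract a t) <= rnorm a * proj_norm t.
Proof.
apply: proj_norm_morphism; first exact: rnorm_ge0.
  by split=> [|u v]; rewrite ?raddf0 ?raddfD.
move=> x y; rewrite tensor_ract_pure (le_trans (proj_norm_pure _ _)) //.
by rewrite mulrCA ler_wpM2l ?rnorm_ge0 // mulrC rnorm_cmul.
Qed.

(** The inner action on the two legs. It commutes with the outer bimodule action, hence with
    commutators, and is contractive when [b] and [b'] are. *)
Definition tensor_insert (b b' : A) : tensor A A -> tensor A A :=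
  tensor_lift (fun x y => pure_tensor (cmul x b) (cmul b' y)).

Lemma tensor_insert_bilinear b b' :
  bilinear_for *:%R *:%R (fun x y => pure_tensor (cmul x b) (cmul b' y)).
Proof.
split=> [y|x] c u v /=.
  by rewrite cmulDl cmulZl pure_tensorDl pure_tensorZl.
by rewrite cmulDr cmulZr pure_tensorDr pure_tensorZr.
Qed.

HB.instance Definition _ b b' := GRing.isLinear.Build R[i] (tensor A A)
  (tensor A A) *:%R (tensor_insert b b')
  (tensor_lift_linear (tensor_insert_bilinear b b')).

Lemma tensor_insert_pure b b' x y :
  tensor_insert b b' (pure_tensor x y) = pure_tensor (cmul x b) (cmul b' y).
Proof. by rewrite /tensor_insert tensor_lift_pure //; exact: tensor_insert_bilinear. Qed.

Lemma tensor_ext (V : lmodType R[i]) (f g : {linear tensor A A -> V}) :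
  (forall x y, f (pure_tensor x y) = g (pure_tensor x y)) -> f =1 g.
Proof.
move=> fg t; rewrite (tensor_sum t) !raddf_sum; apply: eq_bigr => p _.
exact: fg.
Qed.

Lemma tensor_insert_lact a b b' t :
  tensor_insert b b' (tensor_lact a t) = tensor_lact a (tensor_insert b b' t).
Proof.
apply: (@tensor_ext _ (tensor_insert b b' \o tensor_lact a)
  (tensor_lact a \o tensor_insert b b')) => x y /=.
by rewrite !(tensor_lact_pure, tensor_insert_pure) cmulA.
Qed.

Lemma tensor_insert_ract a b b' t :
  tensor_insert b b' (tensor_ract a t) = tensor_ract a (tensor_insert b b' t).
Proof.
apply: (@tensor_ext _ (tensor_insert b b' \o tensor_ract a)
  (tensor_ract a \o tensor_insert b b')) => x y /=.
by rewrite !(tensor_ract_pure, tensor_insert_pure) cmulA.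
Qed.

Lemma proj_norm_insert b b' t :
  rnorm b <= 1 -> rnorm b' <= 1 ->
  proj_norm (tensor_insert b b' t) <= proj_norm t.
Proof.
move=> b1 b'1; rewrite -[leRHS]mul1r; apply: proj_norm_morphism => //.
  by split=> [|u v]; rewrite ?raddf0 ?raddfD.
move=> x y; rewrite tensor_insert_pure (le_trans (proj_norm_pure _ _)) // mul1r.
rewrite ler_pM ?rnorm_ge0 // (le_trans (rnorm_cmul _ _)) //.
  by rewrite ler_piMr ?rnorm_ge0.
by rewrite ler_piMl ?rnorm_ge0.
Qed.
End ProjectiveNorm.

(** * Neumann series, Cayley transform and generation by unitaries *)

Section CstarAlgebra.
Context (R : realType) (A : cstarAlgType R).
Local Notation "x ** y" := (cmul x y) (at level 40, left associativity).
Local Notation one := (cone A).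
Implicit Types (x y a : A) (c : R[i]).

Lemma cmulNr x y : x ** (- y) = - (x ** y).
Proof. by rewrite -(scaleN1r y) cmulZr scaleN1r. Qed.

Lemma cmulNl x y : (- x) ** y = - (x ** y).
Proof. by rewrite -(scaleN1r x) cmulZl scaleN1r. Qed.

Lemma cmulBr x y a : a ** (x - y) = a ** x - a ** y.
Proof. by rewrite cmulDr cmulNr. Qed.

Lemma cmulBl x y a : (x - y) ** a = x ** a - y ** a.
Proof. by rewrite cmulDl cmulNl. Qed.

Lemma cmul_cvg (u : nat -> A) x y : u @ \oo --> y ->
  (fun n => x ** u n) @ \oo --> x ** y /\ (fun n => u n ** x) @ \oo --> y ** x.
Proof.
move=> uy; have x0 : 0 < `|x| + 1%R by rewrite ltr_wpDl.
split; apply/cvgrPdist_lt => e e0; move/cvgrPdist_lt: uy => /(_ (e / (`|x| + 1))).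
  rewrite divr_gt0 // => /(_ isT); apply: filterS => n yn.
  rewrite -cmulBr (le_lt_trans (cnormM _ _)) //.
  rewrite ltr_pdivlMr // in yn; rewrite (le_lt_trans _ yn) // mulrC.
  by rewrite ler_wpM2l // lerDl.
rewrite divr_gt0 // => /(_ isT); apply: filterS => n yn.
rewrite -cmulBl (le_lt_trans (cnormM _ _)) //.
rewrite ltr_pdivlMr // in yn; rewrite (le_lt_trans _ yn) //.
by rewrite ler_wpM2l // lerDl.
Qed.

Section Neumann.
Variable x : A.
Hypothesis x_small : rnorm x <= 2^-1.

(** The partial sums [1 + x + ... + x^n] of the Neumann series of [(1 - x)^-1]. *)
Let y n : A := iter n (fun z => one + x ** z) one.

Let yC n : x ** y n = y n ** x.
Proof.
elim: n => [|n IHn]; first by rewrite cmul1 cmulr1.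
by rewrite /= cmulDl cmulDr cmul1 cmulr1 {1}IHn cmulA.
Qed.

Let x_half (z : A) : rnorm (x ** z) <= 2^-1 * rnorm z.
Proof. by rewrite (le_trans (rnorm_cmul _ _)) // ler_wpM2r ?rnorm_ge0. Qed.

Let y_bound n : rnorm (y n) <= 2 * rnorm one.
Proof.
elim: n => [|n IHn]; first by rewrite ler_peMl ?rnorm_ge0 ?ler1n.
rewrite (le_trans (rnormD _ _)) //= (le_trans (lerD (lexx _) (x_half _))) //.
by move: IHn; set b := rnorm (y n); lra.
Qed.

Let y_cauchy n k : rnorm (y (n + k) - y n) <= 2^-1 ^+ n * (3 * rnorm one).
Proof.
elim: n => [|n IHn].
  (* The factor 3 is the 2 of [y_bound] plus 1 for [y 0 = one]. *)
  rewrite expr0 mul1r (le_trans (rnormD _ _)) // rnormN.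
  by rewrite (le_trans (lerD (y_bound _) (lexx _))) //; lra.
rewrite /= opprD addrACA subrr add0r -cmulBr (le_trans (x_half _)) //.
by rewrite exprS -mulrA ler_wpM2l ?invr_ge0.
Qed.

Lemma neumann_inverse : exists y : A, (one - x) ** y = one /\ y ** (one - x) = one.
Proof.
have /cvg_ex[z yz] : cvg (y @ \oo).
  apply/cauchy_cvgP/cauchy_exP => e e0.
  have eE : e = (complex.Re e)%:C%C by rewrite RRe_real // gtr0_real.
  have Re0 : 0 < complex.Re e by rewrite -ltcR -eE.
  set C := 3 * rnorm one; have C0 : 0 <= C by rewrite mulr_ge0 // rnorm_ge0.
  (* With this [n], [C / complex.Re e < 2 ^ m] for all [m >= n], so the geometric tail after [n] is
     below [e]. *)
  pose n := Num.bound (C / complex.Re e).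
  exists (y n); exists n => // m /= nm; rewrite -ball_normE /= eE distrC.
  rewrite -rnormE ltcR -(subnKC nm) (le_lt_trans (y_cauchy _ _)) // -/C.
  rewrite exprVn mulrC ltr_pdivrMr ?exprn_gt0 // mulrC -ltr_pdivrMr //.
  exact: upper_nthrootP.
(* The recursion passes to the limit on either side, as [x] commutes with each [y n]:
   [z = 1 + x z = 1 + z x]. *)
have yS : (fun n => y n.+1) @ \oo --> z by rewrite (cvg_shiftS y).
have [xy yx] := cmul_cvg x yz.
have {}yx : (fun n => x ** y n) @ \oo --> z ** x.
  by rewrite (_ : (fun _ => _) = (fun n => y n ** x)) //; apply/funext.
have zl : z = one + x ** z.
  apply: (cvg_unique _ yS); first exact: norm_hausdorff.
  exact: (cvgD (cvg_cst _) xy).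
have zr : z = one + z ** x.
  apply: (cvg_unique _ yS); first exact: norm_hausdorff.
  exact: (cvgD (cvg_cst _) yx).
exists z; split; first by rewrite cmulBl cmul1 {1}zl addrK.
by rewrite cmulBr cmulr1 {1}zr addrK.
Qed.
End Neumann.

(* The Cayley transform [(1 + x) (1 - x)^-1 = 2 (1 - x)^-1 - 1]. *)
Lemma cayley_unitary x y : star x = - x ->
  (one - x) ** y = one -> y ** (one - x) = one -> unitaries (y + y - one).
Proof.
move=> xN xy yx.
have syx : star y ** (one + x) = one.
  by have := congr1 (@star R A) xy; rewrite starM starB xN star1 opprK.
have xsy : (one + x) ** star y = one.
  by have := congr1 (@star R A) yx; rewrite starM starB xN star1 opprK.
have uE : y + y - one = (one + x) ** y.
  have -> : one + x = one + one - (one - x) by rewrite opprB addrACA subrr addr0.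
  by rewrite cmulBl cmulDl cmul1 xy.
have uE' : y + y - one = y ** (one + x).
  have -> : one + x = one + one - (one - x) by rewrite opprB addrACA subrr addr0.
  by rewrite cmulBr cmulDr cmulr1 yx.
have sE : star (y + y - one) = (one - x) ** star y.
  by rewrite uE' starM starD star1 xN.
split.
  by rewrite sE uE cmulA -[_ ** (one + x)]cmulA syx cmulr1.
by rewrite sE uE cmulA -[_ ** (one - x)]cmulA yx cmulr1.
Qed.

(** For a small skew-adjoint [x], the inverse [y] of [1 - x] is half the sum of 1 and the Cayley
    transform, so [L] contains [y], then its inverse [1 - x], then [x]. Scaling and the splitting of
    an element into skew-adjoint parts give the rest. *)
Lemma unitary_generation (L : set A) :
    (forall u, unitaries u -> L u) ->
    (forall x y, L x -> L y -> L (x + y)) ->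
    (forall c x, L x -> L (c *: x)) ->
    (forall x y, L x -> x ** y = one -> y ** x = one -> L y) ->
  forall a, L a.
Proof.
move=> LU LD LZ LV.
have L1 : L one by exact/LU/unitary1.
have LB x y : L x -> L y -> L (x - y).
  by move=> Lx Ly; apply: LD => //; rewrite -scaleN1r; exact: LZ.
have Lsmall x : star x = - x -> rnorm x <= 2^-1 -> L x.
  move=> xN /neumann_inverse[y [xy yx]].
  have Ly : L y.
    have -> : y = 2^-1 *: ((y + y - one) + one).
      by rewrite subrK -mulr2n -(scaler_nat 2 y) scalerA mulVf ?scale1r ?pnatr_eq0.
    by apply: LZ; apply: LD => //; exact/LU/(cayley_unitary xN).
  by rewrite -(subKr one x); apply: LB => //; exact: LV Ly yx xy.
have Lskew x : star x = - x -> L x.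
  (* Dividing by [r] brings the norm to at most 1/2; the added 1 keeps [r] positive when [x = 0]. *)
  move=> xN; pose r : R := 2 * (1 + rnorm x).
  have r0 : 0 < r by rewrite mulr_gt0 // ltr_wpDr ?rnorm_ge0.
  have -> : x = r%:C%C *: (r^-1%:C%C *: x).
    by rewrite scalerA -rmorphM /= mulfV ?scale1r // gt_eqF.
  apply/LZ/Lsmall.
    by rewrite starZ xN scalerN conj_Creal // ger0_real // ler0c invr_ge0 ltW.
  rewrite rnorm_scale rnorm_real ?invr_ge0 ?(ltW r0) // ler_pdivrMl //.
  by rewrite /r mulrC mulKf // lerDr.
(* Both [s] and [t] are skew-adjoint, and [a = s - 'i *: t]. *)
move=> a; pose s := 2^-1 *: (a - star a); pose t := (2^-1 * 'i) *: (a + star a).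
have c2 : (2^-1 : R[i])^* = 2^-1 by rewrite rmorphV /= ?unitfE ?pnatr_eq0 // rmorph_nat.
have sN : star s = - s by rewrite starZ c2 starB starK -scalerN opprB.
have tN : star t = - t.
  by rewrite starZ starD starK rmorphM /= conjCi c2 mulrN scaleNr addrC.
have -> : a = s - 'i *: t.
  rewrite /t scalerA mulrCA -expr2 sqrCi mulrN1 scaleNr opprK -scalerDr.
  rewrite addrACA addNr addr0 -mulr2n.
  by rewrite -(scaler_nat 2 a) scalerA mulVf ?scale1r ?pnatr_eq0.
by apply: LB; [|apply: LZ]; exact: Lskew.
Qed.
End CstarAlgebra.

Section PureTensorB.
Context (K : comNzRingType) (U V : lmodType K).

Lemma pure_tensorBl (u u' : U) (v : V) :
  pure_tensor (u - u') v = pure_tensor u v - pure_tensor u' v.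
Proof. by rewrite pure_tensorDl -scaleN1r pure_tensorZl scaleN1r. Qed.

Lemma pure_tensorBr (u : U) (v v' : V) :
  pure_tensor u (v - v') = pure_tensor u v - pure_tensor u v'.
Proof. by rewrite pure_tensorDr -scaleN1r pure_tensorZr scaleN1r. Qed.
End PureTensorB.

(** * Means of norm one *)

Section Mean.
Context (R : realType) (G : topologicalGroupType) (mu : {scalar rucb R G}).
Hypotheses (mu1 : mu (rucb_one R G) = 1) (mu_norm : dual_norm mu = 1%E).

Lemma mean_bound (F : rucb R G) (M : R) :
  0 < M -> (forall y, rnorm (F y) <= M) -> rnorm (mu F) <= M.
Proof.
move=> M0 FM; have Mi : 0 <= M^-1 by rewrite invr_ge0 ltW.
have : ((rnorm (mu (M^-1%:C%C *: F)))%:E <= dual_norm mu)%E.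
  apply: ereal_sup_ubound; exists (M^-1%:C%C *: F) => //=.
  apply: sup_norm_le => y; rewrite [X in rnorm X](_ : _ = M^-1%:C%C * F y) //.
  by rewrite rnormM rnorm_real // ler_pdivrMl // mulr1.
rewrite mu_norm lee_fin linearZ /= rnormM rnorm_real // ler_pdivrMl //.
by rewrite mulr1.
Qed.

(** Positivity of the mean is replaced by a norm estimate: [M' - F] takes values in [[0, M' - e]],
    but its mean would be [M'] if [mu F] vanished. *)
Lemma mean_neq0 (F : rucb R G) (r : G -> R) (e : R) :
  (forall u, F u = (r u)%:C%C) -> 0 < e -> (forall u, e <= r u) -> mu F != 0.
Proof.
move=> Fr e0 er; have [[M FM] _] := set_mem (rucb_valP F).
(* Large enough that [M'] dominates [F] and [M' - e] is positive, as [mean_bound] requires. *)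
pose M' := `|M| + e + 1.
have Me : 0 < M' - e by rewrite /M' addrAC addrK ltr_wpDl.
have M'0 : 0 <= M' by rewrite !addr_ge0 // ltW.
apply/eqP => F0; have := @mean_bound (M'%:C%C *: rucb_one R G - F) _ Me.
rewrite linearB linearZ /= mu1 F0 subr0 mulr1 rnorm_real //.
suff bnd y : rnorm ((M'%:C%C *: rucb_one R G - F) y) <= M' - e.
  by move=> /(_ bnd); rewrite lerBrDr gerDl leNgt e0.
rewrite [X in rnorm X](_ : _ = M'%:C%C * 1 - F y) // mulr1 Fr -rmorphB /=.
have rM : r y <= M.
  have := FM y; rewrite Fr rnorm_real //.
  exact: le_trans (ltW e0) (er y).
have rM' : r y <= M'.
  by rewrite (le_trans rM) // (le_trans (ler_norm _)) // /M' -addrA lerDl addr_ge0 // ltW.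
by rewrite rnorm_real ?subr_ge0 // lerD2l lerN2.
Qed.
End Mean.

(** * Functions on the unitary group induced by functionals on the tensor product *)

Section UnitaryDiagonal.
Context (R : realType) (A : cstarAlgType R).
Local Notation AA := (tensor A A).
Local Notation U := (unitary_group A).
Implicit Types (u v y : U) (a b : A) (t : AA) (f : AA -> R).

Definition unitary_diag u : AA := pure_tensor (val u) (star (val u)).

Lemma unitary_starK u : cmul (star (val u)) (val u) = cone A.
Proof. by case: (set_mem (valP u)). Qed.

Lemma unitary_starKr u : cmul (val u) (star (val u)) = cone A.
Proof. by case: (set_mem (valP u)). Qed.

Lemma rnorm_unitary_val u : rnorm (val u : A) <= 1.
Proof. exact/rnorm_unitary/set_mem/valP. Qed.

Lemma rnorm_star a : rnorm (star a) = rnorm a.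
Proof. by rewrite /rnorm normr_star. Qed.

Lemma proj_norm_unitary_diag u : proj_norm (unitary_diag u) <= 1.
Proof.
rewrite (le_trans (proj_norm_pure _ _)) // rnorm_star.
by rewrite mulr_ile1 ?rnorm_ge0 ?rnorm_unitary_val.
Qed.

(** With [d = u - 1], the difference is [d y] tensor [star (u y)] plus [y] tensor
    [star y ** star d]. Uniformity in [y] is what membership in RUCB demands. *)
Lemma unitary_diagM u y :
  proj_norm (unitary_diag (u * y)%g - unitary_diag y) <=
  2 * rnorm (val u - cone A).
Proof.
set d := val u - cone A.
have -> : unitary_diag (u * y)%g - unitary_diag y =
    pure_tensor (cmul d (val y)) (star (val (u * y)%g)) +
    pure_tensor (val y) (cmul (star (val y)) (star d)).
  rewrite /unitary_diag /= /d starB star1 starM cmulBl cmulBr cmul1 cmulr1.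
  by rewrite pure_tensorBl pure_tensorBr addrA subrK.
have nd (w : U) : rnorm (star (val w)) <= 1 by rewrite rnorm_star rnorm_unitary_val.
rewrite mulr2n mulrDl mul1r (le_trans (proj_normD _ _)) // lerD //.
  rewrite (le_trans (proj_norm_pure _ _)) // -[leRHS]mulr1 ler_pM ?rnorm_ge0 //.
  rewrite (le_trans (rnorm_cmul _ _)) // ler_piMr ?rnorm_ge0 //.
  exact: rnorm_unitary_val.
rewrite (le_trans (proj_norm_pure _ _)) // -[leRHS]mul1r ler_pM ?rnorm_ge0 //.
  exact: rnorm_unitary_val.
rewrite (le_trans (rnorm_cmul _ _)) // !rnorm_star.
by rewrite ler_piMl ?rnorm_ge0 ?rnorm_unitary_val.
Qed.

(** Real-valued and additive, as delivered by Hahn-Banach on a group. The bound is stated from above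
    only; applying it to [- t] gives the other side. *)
Definition bounded_additive f :=
  {morph f : s t / s + t} /\ exists M, forall t, f t <= M * proj_norm t.

Lemma bounded_additiveN f t : bounded_additive f -> f (- t) = - f t.
Proof.
move=> [fD _]; have f0 : f 0 = 0 by apply: (addrI (f 0)); rewrite -fD !addr0.
by apply/eqP; rewrite -addr_eq0 -fD addNr f0.
Qed.

Lemma bounded_additive_norm f : bounded_additive f ->
  exists2 M, 0 < M & forall t, `|f t| <= M * proj_norm t.
Proof.
move=> fa; have [_ [M fM]] := fa; exists (`|M| + 1) => [|t].
  by rewrite ltr_wpDl.
have le t' : f t' <= (`|M| + 1) * proj_norm t'.
  rewrite (le_trans (fM _)) // ler_wpM2r ?proj_norm_ge0 //.
  by rewrite (le_trans (ler_norm _)) // lerDl.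
by rewrite ler_norml le andbT lerNl -bounded_additiveN // -(proj_normN t) le.
Qed.

Lemma bounded_additive_comp f (g : {linear AA -> AA}) (c : R) :
  0 <= c -> (forall t, proj_norm (g t) <= c * proj_norm t) ->
  bounded_additive f -> bounded_additive (f \o g).
Proof.
move=> c0 gc fa; have [M M0 fM] := bounded_additive_norm fa.
split=> [s t /=|]; first by rewrite raddfD (proj1 fa).
exists (M * c) => t /=; rewrite (le_trans (ler_norm _)) // (le_trans (fM _)) //.
by rewrite -mulrA ler_pM2l.
Qed.

Lemma bounded_additive_rucb f : bounded_additive f ->
  rucb_set (fun u => (f (unitary_diag u))%:C%C : R[i]^o).
Proof.
move=> fa; have [M M0 fM] := bounded_additive_norm fa; have [fD _] := fa.
have rn (r : R) : rnorm (r%:C%C : R[i]^o) = `|r|.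
  by apply: (@complexI R); rewrite rnormE normc_def /= expr0n addr0 sqrtr_sqr.
apply/rucbP; split.
  exists M => u; rewrite rn (le_trans (fM _)) // ler_piMr ?(ltW M0) //.
  exact: proj_norm_unitary_diag.
(* [M] bounds [f], and 2 is the Lipschitz constant of [unitary_diagM]. *)
move=> e e0; have e1 : 0 < e / (M * 2) by rewrite divr_gt0 ?mulr_gt0.
have := @initial_continuous U A val (1%g : U).
move/cvgrPdist_lt => /(_ (e / (M * 2))%:C%C); rewrite (ltcR 0) => /(_ e1).
apply: filterS => u; rewrite distrC -rnormE ltcR => ue y.
rewrite -rmorphB /= rn -bounded_additiveN // -fD (le_trans (fM _)) //.
rewrite (le_trans (ler_wpM2l (ltW M0) (unitary_diagM _ _))) //.
by rewrite mulrA mulrC -ler_pdivlMr ?mulr_gt0 // ltW.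
Qed.

Definition tensor_comm a t : AA := tensor_lact a t - tensor_ract a t.

Lemma tensor_comm_linear a : linear (tensor_comm a).
Proof.
move=> c s t; rewrite /tensor_comm !linearP /= scalerBr.
by rewrite scalerN addrACA.
Qed.

HB.instance Definition _ a := GRing.isLinear.Build R[i] AA AA *:%R
  (tensor_comm a) (tensor_comm_linear a).

Lemma proj_norm_comm a t :
  proj_norm (tensor_comm a t) <= (rnorm a + rnorm a) * proj_norm t.
Proof.
rewrite (le_trans (proj_normD _ _)) // proj_normN mulrDl lerD //.
  exact: proj_norm_lact.
exact: proj_norm_ract.
Qed.

Lemma tensor_comm_diag a u : tensor_comm a (unitary_diag u) =
  pure_tensor (cmul a (val u)) (star (val u)) -
  pure_tensor (val u) (cmul (star (val u)) a).
Proof. by rewrite /tensor_comm tensor_lact_pure tensor_ract_pure. Qed.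

Lemma rucb_comm f a : bounded_additive f ->
  exists F : rucb R U, forall u, F u = (f (tensor_comm a (unitary_diag u)))%:C%C.
Proof.
move=> fa; have ca : bounded_additive (f \o tensor_comm a).
  apply: bounded_additive_comp fa; last exact: proj_norm_comm.
  by rewrite addr_ge0 ?rnorm_ge0.
by exists (Rucb (mem_set (bounded_additive_rucb ca))).
Qed.

Section InvariantMean.
Variable mu : {scalar rucb R U}.
Hypothesis mu_inv : forall u F, mu (rucb_trans u F) = mu F.

Lemma mean_comm a f (F : rucb R U) : bounded_additive f ->
  (forall u, F u = (f (tensor_comm a (unitary_diag u)))%:C%C) -> mu F = 0.
Proof.
pose central a := forall f (F : rucb R U), bounded_additive f ->
  (forall u, F u = (f (tensor_comm a (unitary_diag u)))%:C%C) -> mu F = 0.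
(* The elements with this property form a subspace. It contains the unitaries by
   invariance of [mu], as [v (u (x) u^* ) = ((v u) (x) (v u)^* ) v], and it is
   closed under inverses, as [[a^-1, t] = - a^-1 [a, t] a^-1]. *)
apply: (@unitary_generation _ _ central) => {a f F}
  [v vU|a b ca cb|c a ca|a b ca ab ba] f F fa FE.
- pose w : U := SigSub (mem_set vU).
  have ra : bounded_additive (f \o tensor_ract v).
    apply: bounded_additive_comp fa; last exact: proj_norm_ract.
    exact: rnorm_ge0.
  pose H := Rucb (mem_set (bounded_additive_rucb ra)).
  suff -> : F = rucb_trans w H - H by rewrite linearB /= mu_inv subrr.
  apply/val_inj/funext => u; rewrite /= FE.
  rewrite [RHS](_ : _ = H (w * u)%g - H u) // /H /= -rmorphB /=.
  congr (_ %:C)%C; rewrite -bounded_additiveN // -(proj1 fa); congr f.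
  rewrite tensor_comm_diag !tensor_ract_pure /= starM -cmulA.
  by have := unitary_starK w; rewrite /= => ->; rewrite cmulr1.
- have [Fa FaE] := rucb_comm a fa; have [Fb FbE] := rucb_comm b fa.
  have -> : F = Fa + Fb.
    apply/val_inj/funext => u; rewrite [RHS](_ : _ = Fa u + Fb u) //.
    rewrite /= FE FaE FbE -rmorphD /= -(proj1 fa); congr (f _)%:C%C.
    rewrite !tensor_comm_diag cmulDl cmulDr pure_tensorDl pure_tensorDr.
    by rewrite opprD addrACA.
  by rewrite linearD /= (ca _ _ fa FaE) (cb _ _ fa FbE) addr0.
(* As [f] is only additive, the complex scalar is moved into the functional. *)
- apply: (ca (f \o *:%R c)).
    apply: (@bounded_additive_comp f ( *:%R c) (rnorm c)) fa.
      exact: rnorm_ge0.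
    by move=> t; exact: proj_norm_scale.
  move=> u; rewrite FE /=; congr (f _)%:C%C.
  by rewrite !tensor_comm_diag cmulZl cmulZr pure_tensorZl pure_tensorZr scalerBr.
- pose g : {linear AA -> AA} := tensor_lact b \o tensor_ract b.
  have ga : bounded_additive (f \o g).
    apply: (@bounded_additive_comp f g (rnorm b * rnorm b)) => //.
      by rewrite mulr_ge0 ?rnorm_ge0.
    move=> t /=; rewrite (le_trans (proj_norm_lact _ _)) // -mulrA.
    by rewrite ler_wpM2l ?rnorm_ge0 // proj_norm_ract.
  (* The sign in the commutator formula makes [- F] the function attached to [a] and [f \o g]. *)
  apply/eqP; rewrite -oppr_eq0 -raddfN; apply/eqP; apply: (ca _ _ ga) => u.
  rewrite [LHS](_ : _ = - F u) // FE -rmorphN /=; congr (_ %:C)%C.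
  rewrite -bounded_additiveN //; congr f.
  rewrite !tensor_comm_diag opprB !raddfB /=.
  rewrite !(tensor_ract_pure, tensor_lact_pure) !cmulA ba cmul1.
  by rewrite -[cmul (cmul _ a) b]cmulA ab cmulr1.
Qed.
End InvariantMean.
End UnitaryDiagonal.

(** * Almost central averages and their symmetrization *)

Section AverageDiagonal.
Context (R : realType) (A : cstarAlgType R).
Local Notation AA := (tensor A A).
Local Notation U := (unitary_group A).
Implicit Types (u v : U) (a : A) (s : seq U).

Definition diag_sum s : AA := \sum_(u <- s) unitary_diag u.

(** Lists with repetition stand for averages with rational weights. Unnormalized sums are closed
    under addition, as the separation requires, and the factor [size s] restores the
    normalization. *)
Lemma almost_central_diag_sum (mu : {scalar rucb R U}) (I : finType)
    (a : I -> A) (e : R) :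
    mu (rucb_one R U) = 1 -> dual_norm mu = 1%E ->
    (forall u F, mu (rucb_trans u F) = mu F) -> 0 < e ->
  exists2 s : seq U, s != [::] &
    forall i, proj_norm (tensor_comm (a i) (diag_sum s)) < e * (size s)%:R.
Proof.
move=> mu1 mu_norm mu_inv e0.
pose V : zmodType := {ffun I -> AA}.
pose N (x : V) := \sum_i proj_norm (x i).
pose c t : V := [ffun i => tensor_comm (a i) t].
have cD t t' : c (t + t') = c t + c t'.
  by apply/ffunP => i; rewrite !ffunE raddfD.
apply: contrapT => no_s.
have Ns : sublinear N.
  split=> [x y|n x].
    rewrite /N -big_split; apply: ler_sum => i _ /=.
    by rewrite ffunE; exact: proj_normD.
  rewrite /N -sumrMnl; apply: ler_sum => i _.
  by rewrite ffunMnE; exact: (proj2 (@proj_norm_sublinear _ _)).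
(* If no [s] works, separate the sums of the [c (unitary_diag u)] from [0] by [q]
   and write [q \o c] as a sum of functionals to which [mean_comm] applies. *)
pose K : set (V * R) := range (fun s => (c (diag_sum s), e * (size s)%:R)).
have [|_ _ [s _ <-] [s' _ <-]||q [qD qN qK]] := @additive_separation _ V N K Ns.
- exists [::] => //; rewrite /diag_sum big_nil mulr0; congr (_, _).
  by apply/ffunP => i; rewrite !ffunE raddf0.
- exists (s ++ s') => //; rewrite /diag_sum big_cat cD size_cat natrD mulrDr.
  by [].
- move=> _ [s _ <-] /=; rewrite leNgt; apply/negP => sN.
  have [s0|s0] := eqVneq s [::].
    move: sN; rewrite s0 /= mulr0 ltNge sumr_ge0 // => i _.
    exact: proj_norm_ge0.
  apply: no_s; exists s => // i; apply: le_lt_trans sN.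
  rewrite /N (bigD1 i) //= ffunE lerDl sumr_ge0 // => j _.
  exact: proj_norm_ge0.
pose d i t : V := [ffun j => if j == i then t else 0].
have q_sum (J : finType) (x : J -> V) : q (\sum_j x j) = \sum_j q (x j).
  have q0 : q 0 = 0 by apply: (addrI (q 0)); rewrite -qD !addr0.
  exact: (big_morph q qD q0).
have qa i : bounded_additive (q \o d i).
  split=> [t t' /=|].
    rewrite -qD; congr q; apply/ffunP => j; rewrite !ffunE.
    by case: eqP; rewrite ?addr0.
  exists 1 => t; rewrite mul1r (le_trans (qN _)) // /N (bigD1 i) //= ffunE eqxx.
  rewrite big1 ?addr0 // => j /negPf ji.
  by rewrite ffunE ji proj_norm0.
pose F i := sval (cid (rucb_comm (a i) (qa i))).
have FE i u : F i u = (q (d i (tensor_comm (a i) (unitary_diag u))))%:C%C.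
  by rewrite /F; case: cid => G /= ->.
have sumE (J : seq I) u : (\sum_(i <- J) F i) u = \sum_(i <- J) F i u.
  elim: J => [|i J IHJ]; first by rewrite !big_nil.
  by rewrite !big_cons -IHJ.
have SE u : (\sum_i F i) u = (q (c (unitary_diag u)))%:C%C.
  rewrite sumE (eq_bigr _ (fun i _ => FE i u)) -rmorph_sum -q_sum /=.
  congr (q _)%:C%C; apply/ffunP => i; rewrite sum_ffunE ffunE (bigD1 i) //=.
  rewrite ffunE eqxx big1 ?addr0 // => j ji.
  by rewrite ffunE eq_sym (negPf ji).
(* Separation at singleton lists gives [e <= q (c (unitary_diag u))] for every [u], so this mean
   cannot vanish, whereas each summand has mean zero. *)
have : mu (\sum_i F i) != 0.
  apply: (mean_neq0 mu1 mu_norm SE e0) => u.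
  have Ku : K (c (diag_sum [:: u]), e * 1) by exists [:: u].
  by have := qK _ Ku; rewrite /= mulr1 /diag_sum big_seq1.
rewrite raddf_sum big1 ?eqxx // => i _.
exact: (mean_comm mu_inv (qa i) (FE i)).
Qed.

Definition diag_avg s : AA := (size s)%:R^-1 *: diag_sum s.

(** By induction on the list: the average of [u :: t] is the convex combination with weight
    [1 / (size t + 1)] on [u] and the rest on the average of [t]. *)
Lemma diag_avg_hull s : s != [::] ->
  convex_hull [set pure_tensor (star u) u | u in @unitaries R A] (diag_avg s).
Proof.
move=> s0 C [Cconv SC].
have Cdiag u : C (unitary_diag u).
  (* The hull is spanned by the [star w] tensor [w]; here [w = star u]. *)
  apply: SC; exists (star (val u)); last by rewrite starK.
  exact/unitary_star/set_mem/valP.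
elim: s s0 => // u [|v s] IHs _.
  by rewrite /diag_avg /diag_sum big_seq1 invr1 scale1r.
have {}IHs := IHs isT; set t := v :: s in IHs *.
have l0 : 0 <= (size t).+1%:R^-1 :> R[i] by rewrite invr_ge0.
have l1 : (size t).+1%:R^-1 <= 1 :> R[i] by rewrite invf_le1 ?ltr0n // ler1n.
have := Cconv _ _ (Itv01 l0 l1) (mem_set (Cdiag u)) (mem_set IHs).
move/set_mem; congr (C _); rewrite /conv /= /diag_avg /diag_sum [in RHS]big_cons.
rewrite scalerDr scalerA; congr (_ + _ *: _).
have n0 : (size t)%:R != 0 :> R[i] by rewrite pnatr_eq0.
have n1 : (size t).+1%:R != 0 :> R[i] by rewrite pnatr_eq0.
apply: (mulIf n0); rewrite mulfVK //; apply: (mulfI n1).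
by rewrite /unstable.onem mulrBr mulfV // mulrA mulfV // mul1r mulr1 -natr1 addrK.
Qed.

Lemma diag_avg_norm s : proj_norm (diag_avg s) <= 1.
Proof.
have [->|s0] := eqVneq s [::].
  by rewrite /diag_avg /diag_sum big_nil scaler0 proj_norm0.
have n0 : 0 < (size s)%:R :> R by rewrite ltr0n lt0n size_eq0.
rewrite (le_trans (proj_norm_scale _ _)) //.
rewrite -(rmorph_nat (real_complex R)) -fmorphV rnorm_real ?invr_ge0 ?ler0n //.
rewrite ler_pdivrMl // mulr1 (le_trans (proj_norm_sum _ _)) //.
rewrite -sum1_size natr_sum; apply: ler_sum => u _.
exact: proj_norm_unitary_diag.
Qed.

Lemma tensor_mult_diag u : tensor_mult (unitary_diag u) = cone A.
Proof. by rewrite tensor_mult_pure unitary_starKr. Qed.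

Lemma diag_avg_mult s : s != [::] -> tensor_mult (diag_avg s) = cone A.
Proof.
move=> s0; rewrite linearZ /= [tensor_mult _]raddf_sum /=.
under eq_bigr => u _ do rewrite tensor_mult_diag.
rewrite big_const_seq count_predT iter_addr addr0 -(scaler_nat _ (cone A)) scalerA.
by rewrite mulVf ?scale1r // pnatr_eq0 size_eq0.
Qed.

(* Passing from [s] to its quotients makes the diagonal symmetric, since the flip
   exchanges the roles of [u] and [v], and keeps it almost central, since it
   amounts to inserting [v^* (x) v] in the middle of the tensors. *)
Definition quotients s : seq U := [seq (u * v^-1)%g | v <- s, u <- s].

Lemma diag_sum_quotients s : diag_sum (quotients s) =
  \sum_(v <- s) tensor_insert (star (val v)) (val v) (diag_sum s).
Proof.
rewrite /diag_sum big_allpairs_dep; apply: eq_bigr => v _.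
rewrite [RHS]raddf_sum; apply: eq_bigr => u _.
by rewrite [RHS]tensor_insert_pure /unitary_diag /= starM starK.
Qed.

Lemma flip_unitary_diag u : tensor_flip (unitary_diag u) = unitary_diag u^-1%g.
Proof. by rewrite tensor_flip_pure /unitary_diag /= starK. Qed.

Lemma flip_diag_avg_quotients s :
  tensor_flip (diag_avg (quotients s)) = diag_avg (quotients s).
Proof.
rewrite linearZ /= /diag_sum [tensor_flip _]raddf_sum; congr (_ *: _).
rewrite /diag_sum !big_allpairs_dep exchange_big; apply: eq_bigr => u _ /=.
by apply: eq_bigr => v _; rewrite flip_unitary_diag invgM invgK.
Qed.

(** With [n = size s], the sum over the quotients consists of [n] insertions into [diag_sum s], each
    with commutator of norm at most [e n]; the average divides by [n * n]. *)
Lemma comm_diag_avg_quotients a s (e : R) : s != [::] ->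
  proj_norm (tensor_comm a (diag_sum s)) <= e * (size s)%:R ->
  proj_norm (tensor_comm a (diag_avg (quotients s))) <= e.
Proof.
move=> s0 se; have n0 : 0 < (size s)%:R :> R by rewrite ltr0n lt0n size_eq0.
rewrite linearZ /= (le_trans (proj_norm_scale _ _)) // size_allpairs.
rewrite -(rmorph_nat (real_complex R)) -fmorphV rnorm_real ?invr_ge0 ?ler0n //.
rewrite natrM ler_pdivrMl ?mulr_gt0 // diag_sum_quotients [tensor_comm _ _]raddf_sum.
have -> : (size s)%:R * (size s)%:R * e = \sum_(v <- s) e * (size s)%:R.
  rewrite big_const_seq count_predT iter_addr addr0 -[RHS]mulr_natr.
  by rewrite mulrC mulrA.
apply: (le_trans (proj_norm_sum _ _)); apply: ler_sum => v _.
apply: le_trans se; rewrite /= /tensor_comm -tensor_insert_lact -tensor_insert_ract.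
rewrite -raddfB; apply: proj_norm_insert; last exact: rnorm_unitary_val.
by rewrite rnorm_star rnorm_unitary_val.
Qed.
End AverageDiagonal.

(** * The net of symmetric averages *)

Lemma tails_proper_filter (I : Type) (le : I -> I -> Prop) :
  directed le -> ProperFilter (tails le).
Proof.
move=> [[i0] lexx le_tr le_dir]; apply: filter_from_proper; last first.
  by move=> i _; exists i; exact: lexx.
apply: filter_from_filter; first by exists i0.
move=> i j _ _; have [k [ik jk]] := le_dir i j; exists k => // l kl.
by split; [exact: le_tr ik kl | exact: le_tr jk kl].
Qed.

Theorem theorem2p4 (R : realType) (A : cstarAlgType R) :
  amenable R (unitary_group A) -> strongly_amenable A.
Proof.
move=> [mu [mu1 mu_norm mu_inv]].
pose I := (seq A * nat)%type.
(* An index is a finite list of elements to be almost commuted with, together with [n] for the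
   tolerance [1 / (n + 1)], which is positive even at [n = 0]. *)
pose le (i j : I) := {subset i.1 <= j.1} /\ (i.2 <= j.2)%N.
have le_dir : directed le.
  split; first by split; exact: ([::], 0%N).
  - by move=> i; split.
  - by move=> i j k [ij ij'] [jk jk']; split=> [x /ij/jk //|]; exact: leq_trans jk'.
  - move=> i j; exists (i.1 ++ j.1, maxn i.2 j.2).
    by split; split=> [x|] /=; rewrite ?mem_cat ?leq_maxl ?leq_maxr // => ->; rewrite ?orbT.
have /choice[Delta DeltaP] (i : I) : exists t : tensor A A,
    [/\ proj_norm t <= 1, tensor_mult t = cone A, tensor_flip t = t,
        convex_hull [set pure_tensor (star u) u | u in @unitaries R A] t &
        forall a, a \in i.1 -> proj_norm (tensor_comm a t) <= i.2.+1%:R^-1].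
  have e0 : 0 < i.2.+1%:R^-1 :> R by rewrite invr_gt0.
  have [s s0 sP] := almost_central_diag_sum (fun k : 'I_(size i.1) => nth 0 i.1 k)
    mu1 mu_norm mu_inv e0.
  have q0 : quotients s != [::].
    by rewrite -size_eq0 size_allpairs muln_eq0 size_eq0 negb_or s0.
  exists (diag_avg (quotients s)); split.
  - exact: diag_avg_norm.
  - exact: diag_avg_mult.
  - exact: flip_diag_avg_quotients.
  - exact: diag_avg_hull.
  - move=> a ai; apply: comm_diag_avg_quotients => //.
    have ia : (index a i.1 < size i.1)%N by rewrite index_mem.
    by have := ltW (sP (Ordinal ia)); rewrite /= nth_index.
have tails_filter := tails_proper_filter le_dir.
exists I, le, Delta; split=> // [|i|i]; last 2 first.
- by case: (DeltaP i).
- by case: (DeltaP i).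
split.
- by exists 1 => i; case: (DeltaP i).
(* Multiplication sends every member of the net to 1 exactly, so both nets are constant. *)
- move=> a; have multE i : tensor_mult (Delta i) = cone A by case: (DeltaP i).
  have lE : (fun i => cmul (tensor_mult (Delta i)) a) = fun=> a.
    by apply/funext => i; rewrite multE cmul1.
  have rE : (fun i => cmul a (tensor_mult (Delta i))) = fun=> a.
    by apply/funext => i; rewrite multE cmulr1.
  by rewrite lE rE; split; exact: cvg_cst.
(* Beyond the index [([:: a], n)] the list contains [a] and the tolerance is below [e], since
   [e^-1 < n]. *)
move=> a; apply/cvgrPdist_le => e e0; pose n := Num.bound e^-1.
exists ([:: a], n) => // i [ai ni] /=.
rewrite sub0r normrN ger0_norm ?proj_norm_ge0 //.
have [_ _ _ _ Da] := DeltaP i.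
apply: le_trans (Da a _) _; first by apply: ai; rewrite inE.
rewrite invf_ple ?posrE ?ltr0n //; apply/ltW.
rewrite (lt_le_trans (archi_boundP _)) ?invr_ge0 ?(ltW e0) // ler_nat.
exact: leqW.
Qed.
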